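(* Let $\alpha\in(0,1)$ and let $U_\alpha^{\mathrm{NP}}(x)=x\wedge 1/\alpha$ be the Neyman--Pearson utility. Let $Q$ be a probability distribution on $\mathcal{Z}^{n+1}$ under which $Z^n$ is exchangeable, and write $O'$ for the orbit $O(z^{n+1})$. A $U_\alpha^{\mathrm{NP}}$-optimal e-value for exchangeability against $Q$ is $$\mathcal{E}^{\mathrm{NP}}(z^{n+1})=\begin{cases}1/\alpha,&\text{if }\mathrm{LR}^{Z_{n+1}|O'}(z_{n+1})>c_\alpha^{O'},\\ k^{O'},&\text{if }\mathrm{LR}^{Z_{n+1}|O'}(z_{n+1})=c_\alpha^{O'},\\ 0,&\text{if }\mathrm{LR}^{Z_{n+1}|O'}(z_{n+1})<c_\alpha^{O'},\end{cases}$$ where $c_\alpha^{O'}$ is the $\alpha$ upper-quantile of $\mathrm{LR}^{Z_{n+1}|O'}(Z_{n+1})$ when $Z_{n+1}$ is uniformly distributed over the $n+1$ entries of the tuple $z^{n+1}$, and $k^{O'}$ is some orbit-dependent constant which ensures that $\mathcal{E}^{\mathrm{NP}}$ is an exact e-value, i.e. $\mathrm{E}^{\mathrm{Unif}(O)}[\mathcal{E}^{\mathrm{NP}}]=1$ for every orbit $O$. This e-value is optimal uniformly in any mixture over orbits and in monotone transformations of the likelihood ratio: it is also $U_\alpha^{\mathrm{NP}}$-optimal against every distribution $\widetilde{Q}$ that mixes the same conditional distributions $Q^{|O}$ over the orbits in another way, and against every such distribution whose orbit-conditional likelihood ratios are non-decreasing functions of $\mathrm{LR}^{Z_{n+1}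|O}$.
   Context: $\mathcal{Z}$ is a sample space (standard Borel, so that regular conditional distributions exist). The permutation group $\Pi(n+1)$ acts on $\mathcal{Z}^{n+1}$ by permuting coordinates, and $O(z^{n+1})=\{\pi z^{n+1}:\pi\in\Pi(n+1)\}$ is the orbit of $z^{n+1}$, a finite set. $\mathrm{Unif}(O)$ is the uniform distribution on the orbit $O$. A distribution is exchangeable if it is invariant under $\Pi(n+1)$; $\mathcal{P}^{\mathrm{exch.}}$ is the set of exchangeable distributions on $\mathcal{Z}^{n+1}$. An e-value is a measurable map $\mathcal{E}:\mathcal{Z}^{n+1}\to[0,\infty]$; it is valid for exchangeability if $\mathrm{E}^P[\mathcal{E}]\le1$ for every $P\in\mathcal{P}^{\mathrm{exch.}}$. It is $U$-optimal against $Q$ if it is valid and maximizes $\mathrm{E}^Q[U(\mathcal{E})]$ over all valid e-values. ''$Z^n$ is exchangeable under $Q$'' means that the law of $Z^{n+1}=(Z^n,Z_{n+1})$ under $Q$ is invariant under permutations of the first $n$ coordinates. $Q^{|O}$ is the conditional distribution of $Z^{n+1}$ under $Q$ given that its orbit is $O$ (a fixed version, defined for every orbit, also invariant under permutations of the first $n$ coordinates). The orbit-conditional likelihood ratio is $\mathrm{LR}^{|O}=dQ^{|O}/d\mathrm{Unif}(O)$; it depends on $z^{n+1}\in O$ only through $z_{n+1}$ and equals $\mathrm{LR}^{Z_{n+1}|O}(z_{n+1})=(n+1)\,Q^{Z_{n+1}|O}(z_{n+1})$. Here $Q^{Z_{n+1}|O}(z)$ is the conditional probability under $Q$ that $Z_{n+1}=z$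 given orbit $O$; if the value $z$ occurs $m$ times in the tuples in $O$, its mass is divided equally over these $m$ occurrences (i.e. divided by $m$), so that each of the $n+1$ positions has reference mass $1/(n+1)$. The $\alpha$ upper-quantile of a random variable $X$ is a value $c$ with $\Pr(X>c)\le\alpha\le\Pr(X\ge c)$. *)

(* Defs.v *)
From mathcomp Require Import all_boot all_order all_algebra.
From mathcomp Require Import perm finmap.
From mathcomp Require Import all_classical all_reals all_analysis measurable_realfun.
Set Implicit Arguments.
Unset Strict Implicit.
Unset Printing Implicit Defensive.
Import Order.TTheory GRing.Theory Num.Theory.
Import numFieldNormedType.Exports.
Local Open Scope classical_set_scope.
Local Open Scope ring_scope.

(* [Z] carries the Borel sigma-algebra of a Polish topology, transported along
   the bijection [f]. *)
Definition standard_borel (R : realType) d (Z : measurableType d) : Prop :=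
  exists (X : completePseudoMetricType R) (f : Z -> X),
    [/\ bijective f,
        hausdorff_space X,
        (exists2 D : set X, countable D & dense D) &
        forall A : set X, measurable (f @^-1` A) <-> <<s open >> A].

(* The empirical law of the entries of [s], counted with multiplicity. *)
Definition unif_entries (R : realType) d (Z : measurableType d) (s : seq Z) :
    {measure set Z -> \bar R} :=
  mscale ((size s)%:R^-1)%:nng (msum (fun i => \d_(nth point s i)) (size s)).

Section permutations.
Context d (Z : measurableType d) (n : nat).

Definition permute (pi : 'S_n.+1) (z : n.+1.-tuple Z) : n.+1.-tuple Z :=
  [tuple tnth z (pi i) | i < n.+1].

Definition perm_orbit (z : n.+1.-tuple Z) : set (n.+1.-tuple Z) :=
  [set permute pi z | pi in [set: 'S_n.+1]].

(* All tuples of an orbit [O] have the same entries with the same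
   multiplicities, so the representative [get O] is immaterial. *)
Definition mult (O : set (n.+1.-tuple Z)) (x : Z) : nat :=
  count_mem x (get O).

Definition zlast (z : n.+1.-tuple Z) : Z := tnth z ord_max.

End permutations.

Section evalues.
Context (R : realType) d (Z : measurableType d) (n : nat).
Local Notation X := (n.+1.-tuple Z).
Implicit Types (P Q : probability X R) (E : X -> \bar R).

Definition unif_orbit (O : set X) : {measure set X -> \bar R} :=
  unif_entries R (enum_fset (fset_set O)).

Definition exchangeable P : Prop :=
  forall (pi : 'S_n.+1) (A : set X), measurable A ->
    P (permute pi @^-1` A) = P A.

Definition exchangeable_init P : Prop :=
  forall pi : 'S_n.+1, pi ord_max = ord_max ->
  forall A : set X, measurable A -> P (permute pi @^-1` A) = P A.

Definition e_value E : Prop :=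
  measurable_fun [set: X] E /\ forall z, (0 <= E z)%E.

Definition valid E : Prop :=
  e_value E /\
  forall P, exchangeable P -> (\int[P]_z E z <= 1)%E.

Definition U_optimal (U : \bar R -> \bar R) Q E : Prop :=
  valid E /\
  forall E' : X -> \bar R, valid E' ->
    (\int[Q]_z U (E' z) <= \int[Q]_z U (E z))%E.

Definition U_NP (alpha : R) (x : \bar R) : \bar R :=
  Order.min x (alpha^-1)%:E.

(* A family [O |-> K O] of distributions on the orbits, measurable in the
   orbit; the values of [K] at sets that are not orbits play no role. *)
Definition orbit_kernel (K : set X -> probability X R) : Prop :=
  (forall A : set X, measurable A ->
     measurable_fun [set: X] (fun z => K (perm_orbit z) A)) /\
  forall z : X, K (perm_orbit z) (perm_orbit z) = 1%E.

(* Sets of orbits are measurable when the tuples whose orbit they contain form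
   a measurable set. *)
Definition orbit_conditional Q (K : set X -> probability X R) : Prop :=
  orbit_kernel K /\
  forall (A : set X) (S : set (set X)),
    measurable A -> measurable (@perm_orbit d Z n @^-1` S) ->
    (\int[Q]_(z in @perm_orbit d Z n @^-1` S) K (perm_orbit z) A =
     Q (A `&` @perm_orbit d Z n @^-1` S))%E.

(* [Q] draws an orbit O, as the orbit of a tuple with law [mu], and then a tuple
   from [K O]; any law on the orbits arises from some [mu]. *)
Definition orbit_mixture (K : set X -> probability X R) Q : Prop :=
  exists mu : probability X R, forall A : set X, measurable A ->
    Q A = (\int[mu]_z K (perm_orbit z) A)%E.

(* [L O] is a version of dK(O)/dUnif(O) for every orbit O. *)
Definition orbit_LR (K : set X -> probability X R)
    (L : set X -> X -> R) : Prop :=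
  forall (z : X) (A : set X), measurable A ->
    K (perm_orbit z) A =
    (\int[unif_orbit (perm_orbit z)]_(w in A) (L (perm_orbit z) w)%:E)%E.

(* (n+1) Q^{Z_{n+1}|O}(x), the mass of x being shared equally by its
   occurrences. *)
Definition LR_last (K : set X -> probability X R) (O : set X) (x : Z) : R :=
  n.+1%:R * (fine (K O [set w | zlast w = x]) / (mult O x)%:R).

Definition upper_quantile (P : {measure set Z -> \bar R}) (Y : Z -> R)
    (alpha c : R) : Prop :=
  (P [set x | c < Y x]%R <= alpha%:E <= P [set x | c <= Y x]%R)%E.

Definition E_NP (alpha : R) (L : set X -> Z -> R) (c k : set X -> R)
    (z : X) : \bar R :=
  let O := perm_orbit z in
  let l := L O (zlast z) in
  if c O < l then (alpha^-1)%:E else if l == c O then (k O)%:E else 0%E.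

Definition exact_evalue E : Prop :=
  forall z : X, (\int[unif_orbit (perm_orbit z)]_w E w = 1)%E.

End evalues.

(* Main.v *)
Require Import Defs.
From HB Require Import structures.
From mathcomp Require Import all_boot all_order all_algebra.
From mathcomp Require Import perm finmap.
From mathcomp Require Import all_classical all_reals all_analysis measurable_realfun.
From mathcomp Require Import giry.
From mathcomp Require Import ring lra.
Set Implicit Arguments.
Unset Strict Implicit.
Unset Printing Implicit Defensive.
Import Order.TTheory GRing.Theory Num.Theory.
Import numFieldNormedType.Exports.
Local Open Scope classical_set_scope.
Local Open Scope ring_scope.

(* Permuting the coordinates at random turns an exchangeable law into a mixture
   of the uniform laws on orbits, and these laws are exchangeable themselves.
   Hence validity of an e-value means that its average over every orbit is at
   most 1, and the optimization decouples into one finite problem per orbit,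
   which the Neyman-Pearson inequality solves: if [u <= 1/alpha] has orbit
   average at most 1, then [(u - E_NP) * (g LR - g c) <= 0] pointwise for every
   nondecreasing [g], and [g c >= 0] because some value of [LR] is at most [c].
   As the quantile [c] and the constant [k] are chosen orbit by orbit,
   measurability of [E_NP] is not automatic: it holds because exactness makes
   [E_NP] a fixed function of the rank of the last likelihood ratio among those
   of all entries. *)

(** * Measurability in standard Borel spaces *)

Section standard_borel_diagonal.
Context (R : realType) d (Z : measurableType d).
Hypothesis hZ : standard_borel R Z.

(* The complement of the diagonal is the union, over a countable family of open
   sets [B], of the rectangles [B `*` ~` B]. *)
Lemma measurable_diagonal : measurable [set p : Z * Z | p.1 = p.2].
Proof.
case: hZ => X [f [/bij_inj finj hX [D cD dD] mE]].
have fP x y : f x = f y -> x = y by exact: finj.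
pose B (q : X) (k : nat) : set Z := f @^-1` interior (ball q k.+1%:R^-1).
have mB q k : measurable (B q k).
  by apply/mE; apply: sub_sigma_algebra; exact: open_interior.
have -> : [set p : Z * Z | p.1 = p.2] =
    ~` (\bigcup_(q in D) \bigcup_k (B q k `*` ~` B q k)).
  apply/seteqP; split=> [[x y] /= <-|[x y] /= nB]; first by case=> q _ [k _ [? ?]].
  apply/fP; apply: hX; apply: contrapT => ncl; apply: nB.
  have [e nb] : exists e : {posnum R}, ~ ball (f x) e%:num (f y).
    apply: contrapT => /forallNP nb; apply: ncl => U V xU yV.
    have [e /= e0 eU] := (nbhs_ballP (f x) U).1 xU.
    have be : ball (f x) e (f y) by exact: contrapT (nb (PosNum e0)).
    by exists (f y); split; [exact: eU|exact: nbhs_singleton].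
  (* This makes [r] smaller than [e / 2]. If [q] is within [r / 2] of [f x], the ball of radius [r]
     around [q] has [f x] in its interior and misses [f y], because [r / 2 + r <= e]. *)
  pose k := Num.trunc (2 / e%:num).
  pose r : R := k.+1%:R^-1.
  have r0 : 0 < r by rewrite invr_gt0.
  have re : r < e%:num / 2.
    rewrite -[ltRHS]invrK ltf_pV2 ?posrE ?invr_gt0 ?divr_gt0// invf_div.
    by rewrite truncnS_gt.
  have [q [Iq Dq]] : interior (ball (f x) (r / 2)) `&` D !=set0.
    apply: dD; last exact: open_interior.
    by exists (f x); apply: nbhsx_ballx; rewrite divr_gt0.
  have bqx : ball q (r / 2) (f x) by apply: ball_sym; exact: (interior_subset Iq).
  exists q => //; exists k => //; split => /=.
    rewrite /B /= /interior /= nbhs_ballP.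
    exists (r / 2) => /=; first by rewrite divr_gt0.
    by move=> w xw; rewrite -/r (splitr r); exact: ball_triangle xw.
  move=> By; apply: nb.
  have : ball (f x) (r / 2 + r) (f y).
    apply: ball_triangle (interior_subset By).
    exact: (interior_subset Iq).
  apply: le_ball; rewrite [leRHS]splitr lerD//; last exact: ltW.
  by rewrite (le_trans _ (ltW re))// ler_pdivrMr// ler_pMr// ler1n.
apply: measurableC; rewrite bigcup_set_type.
apply: countable_bigcupT_measurable => [|[q ?] /=].
  by rewrite (eq_countable (card_setT D)).
apply: bigcup_measurable => k _; apply: measurableX => //; exact: measurableC.
Qed.

Lemma measurable_singleton (x : Z) : measurable [set x].
Proof.
have := measurable_xsection x measurable_diagonal.
by congr measurable; apply/seteqP; split=> y; rewrite /xsection /= inE //= => ->.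
Qed.

Lemma measurable_tuple_singleton n (z : n.-tuple Z) : measurable [set z].
Proof.
rewrite (_ : [set z] =
    \big[setI/setT]_(i < n) (@tnth n Z ^~ i @^-1` [set tnth z i])).
  apply: bigsetI_measurable => i _; rewrite -[X in measurable X]setTI.
  by apply: measurable_tnth => //; exact: measurable_singleton.
rewrite -bigcap_seq; apply/seteqP; split=> [_ -> i _ //|w wz].
by apply/eq_from_tnth => i; apply: wz; rewrite /= mem_index_enum.
Qed.

End standard_borel_diagonal.

(** * Integration on finitely many atoms *)

Section atomic_integral.
Context d (T : measurableType d) (R : realType) (mu : {measure set T -> \bar R}).
Variable s : seq T.
Hypothesis (us : uniq s) (ms : forall w : T, measurable [set w])
  (mu_s : mu (~` [set` s]) = 0%E).

(** Measurable whatever [F] is, since singletons are, and equal to [F] on the atoms, hence almost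
    everywhere. *)
Let step (F : T -> R) (x : T) : R := \sum_(w <- s) F w * \1_[set w] x.

Let stepE F x : step F x = if x \in s then F x else 0.
Proof.
rewrite /step; case: ifPn => xs.
  rewrite (bigD1_seq x)//= indicE mem_set// mulr1 big1 ?addr0// => w wx.
  by rewrite indicE memNset ?mulr0// => xw; rewrite xw eqxx in wx.
rewrite big1_seq// => w /= ws.
by rewrite indicE memNset ?mulr0// => xw; rewrite xw ws in xs.
Qed.

Let mstep F : measurable_fun setT (EFin \o step F).
Proof.
apply/measurable_EFinP; apply: measurable_sum => w.
exact: measurable_funM.
Qed.

Let integral_step F : (forall x, 0 <= F x) ->
  (\int[mu]_x (step F x)%:E = \sum_(w <- s) (F w)%:E * mu [set w])%E.
Proof.
move=> F0; under eq_integral do rewrite /step -sumEFin.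
rewrite ge0_integral_sum//; last 2 first.
- by move=> w; apply/measurable_EFinP; exact: measurable_funM.
- by move=> w x _; rewrite lee_fin mulr_ge0.
apply: eq_bigr => w _; under eq_integral do rewrite EFinM.
rewrite ge0_integralZl_EFin//; last exact/measurable_EFinP.
by rewrite integral_indic// setIT.
Qed.

Let ae_step (F : T -> R) : measurable_fun setT F -> (forall x, 0 <= F x) ->
  (\int[mu]_x (F x)%:E = \sum_(w <- s) (F w)%:E * mu [set w])%E.
Proof.
move=> mF F0; rewrite -integral_step//.
apply: ge0_ae_eq_integral (measurableT) _ (mstep F) _ _ _ => [|x _|x _|].
- exact/measurable_EFinP.
- by rewrite lee_fin.
- by rewrite lee_fin stepE; case: ifP.
exists (~` [set` s]); split => //.
  apply: measurableC; rewrite -[X in measurable X]image_id -bigcup_imset1.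
  exact: fin_bigcup_measurable.
by move=> x /= nE xs; apply: nE => _ /=; rewrite stepE xs.
Qed.

Import HBNNSimple.

(* No measurability is required: a simple function below [F] is bounded, on the
   atoms, by the measurable step function that agrees with [F] there. *)
Lemma ge0_integral_atoms (F : T -> R) : (forall x, 0 <= F x) ->
  (\int[mu]_x (F x)%:E = \sum_(w <- s) (F w)%:E * mu [set w])%E.
Proof.
move=> F0; apply/eqP; rewrite eq_le; apply/andP; split.
  rewrite ge0_integralTE; last by move=> x; rewrite lee_fin.
  apply: ge_ereal_sup => _ /= [h hF <-]; rewrite -integralT_nnsfun ae_step//.
  by apply: lee_sum => w _; rewrite lee_wpmul2r//; exact: hF.
have step0 x : (0 <= (step F x)%:E)%E by rewrite lee_fin stepE; case: ifP.
rewrite -integral_step// !ge0_integralTE//.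
apply: ereal_sup_le => _ /= [h hF <-]; exists h => //= x.
by rewrite (le_trans (hF x))// stepE lee_fin; case: ifP.
Qed.

Hypothesis mu_fin : fin_num_fun mu.

(** Finiteness of [mu] makes the integrals of the positive and negative parts finite, so they can be
    subtracted. *)
Lemma integral_atoms (F : T -> R) :
  (\int[mu]_x (F x)%:E = (\sum_(w <- s) F w * fine (mu [set w]))%:E)%E.
Proof.
have E G : (forall x, 0 <= G x) ->
    (\int[mu]_x (G x)%:E = (\sum_(w <- s) G w * fine (mu [set w]))%:E)%E.
  move=> G0; rewrite ge0_integral_atoms// -sumEFin; apply: eq_bigr => w _.
  by rewrite EFinM fineK// mu_fin.
rewrite integralE.
rewrite funerpos funerneg.
rewrite !E -?EFinB; [|exact: funrneg_ge0|exact: funrpos_ge0].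
congr EFin; rewrite -sumrB; apply: eq_bigr => w _.
by rewrite -mulrBl -[in RHS](funrposBneg F).
Qed.

End atomic_integral.

(** * Orbits of tuples *)

Section orbits.
Context d (Z : measurableType d) (n : nat).
Local Notation X := (n.+1.-tuple Z).
Implicit Types (z w : X) (pi rho : 'S_n.+1).

Lemma tnth_permute pi z i : tnth (permute pi z) i = tnth z (pi i).
Proof. by rewrite tnth_mktuple. Qed.

Lemma permute1 z : permute 1 z = z.
Proof. by apply: eq_from_tnth => i; rewrite tnth_permute perm1. Qed.

Lemma permuteM pi rho z : permute (pi * rho)%g z = permute pi (permute rho z).
Proof. by apply: eq_from_tnth => i; rewrite !tnth_permute permM. Qed.

Lemma permuteK pi : cancel (@permute d Z n pi) (permute pi^-1).
Proof. by move=> z; rewrite -permuteM mulVg permute1. Qed.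

Lemma permuteKV pi : cancel (permute pi^-1) (@permute d Z n pi).
Proof. by move=> z; rewrite -permuteM mulgV permute1. Qed.

Lemma mem_perm_orbit pi z : perm_orbit z (permute pi z).
Proof. by exists pi. Qed.

Lemma perm_orbit_refl z : perm_orbit z z.
Proof. by exists 1%g => //; exact: permute1. Qed.

Lemma perm_orbit_permute pi z : perm_orbit (permute pi z) = perm_orbit z.
Proof.
apply/seteqP; split=> [_ [rho _ <-]|_ [rho _ <-]].
  by rewrite -permuteM; exact: mem_perm_orbit.
by exists (rho * pi^-1)%g => //; rewrite permuteM permuteK.
Qed.

Lemma perm_orbit_eq z w : perm_orbit z w -> perm_orbit w = perm_orbit z.
Proof. by case=> pi _ <-; exact: perm_orbit_permute. Qed.

Lemma perm_orbit_get z : perm_orbit z (get (perm_orbit z)).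
Proof. by apply: getPex; exists z; exact: perm_orbit_refl. Qed.

Lemma finite_perm_orbit z : finite_set (perm_orbit z).
Proof. exact/finite_image/finite_finset. Qed.

(** The enumeration inside [unif_orbit], so that [unif_orbit] is by conversion the empirical law of
    this sequence. *)
Definition orbit_seq z : seq X := enum_fset (fset_set (perm_orbit z)).

Lemma orbit_seq_uniq z : uniq (orbit_seq z).
Proof. exact: fset_uniq. Qed.

Lemma mem_orbit_seq z w : (w \in orbit_seq z) = (w \in perm_orbit z).
Proof. by rewrite -in_fset_set//; exact: finite_perm_orbit. Qed.

Lemma orbit_seqE z : [set` orbit_seq z] = perm_orbit z.
Proof. by apply/seteqP; split=> w /=; rewrite mem_orbit_seq inE. Qed.

Lemma size_orbit_seq_gt0 z : (0 < size (orbit_seq z))%N.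
Proof.
have : z \in orbit_seq z by rewrite mem_orbit_seq inE; exact: perm_orbit_refl.
by case: (orbit_seq z).
Qed.

Lemma perm_map_orbit_seq pi z :
  perm_eq [seq permute pi w | w <- orbit_seq z] (orbit_seq z).
Proof.
have inj : injective (@permute d Z n pi) by exact: can_inj (permuteK pi).
apply: uniq_perm; rewrite ?map_inj_uniq ?orbit_seq_uniq// => w.
apply/mapP/idP => [[v vz ->]|wz].
  move: vz; rewrite !mem_orbit_seq !inE => -[rho _ <-].
  by rewrite -permuteM; exact: mem_perm_orbit.
exists (permute pi^-1 w); last by rewrite permuteKV.
move: wz; rewrite !mem_orbit_seq !inE => -[rho _ <-].
by rewrite -permuteM; exact: mem_perm_orbit.
Qed.

Lemma tnth_last_split z w : perm_orbit z w -> zlast w = zlast z ->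
  exists2 pi : 'S_n.+1, pi ord_max = ord_max & w = permute pi z.
Proof.
case=> rho _ <-; rewrite /zlast tnth_permute => rmax.
(* The positions [ord_max] and [rho ord_max] of [z] hold the same entry, so swapping them first
   leaves [z] unchanged. *)
exists (rho * tperm ord_max (rho ord_max))%g.
  by rewrite permM tpermR.
rewrite permuteM; congr permute; apply: eq_from_tnth => i.
by rewrite tnth_permute; case: tpermP => [->|->|//].
Qed.

Lemma count_mem_tuple x z :
  count_mem x z = (\sum_(i < n.+1) (tnth z i == x))%N.
Proof.
rewrite -sum1_count big_tuple big_mkcond /=; apply: eq_bigr => i _.
by case: eqP.
Qed.

Lemma count_mem_permute x pi z : count_mem x (permute pi z) = count_mem x z.
Proof.
rewrite !count_mem_tuple [RHS](reindex_inj (@perm_inj _ pi)).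
by apply: eq_bigr => i _; rewrite tnth_permute.
Qed.

Lemma mult_perm_orbit z x : mult (perm_orbit z) x = count_mem x z.
Proof.
by rewrite /mult; case: (perm_orbit_get z) => pi _ <-; exact: count_mem_permute.
Qed.

Lemma measurable_permute pi : measurable_fun setT (@permute d Z n pi).
Proof.
apply/measurable_fun_tnthP => i.
rewrite (_ : _ \o _ = fun z : X => tnth z (pi i)); first exact: measurable_tnth.
by apply/funext => z /=; rewrite tnth_permute.
Qed.

Lemma measurable_perm_orbit (z : X) :
  (forall z : X, measurable [set z]) -> measurable (perm_orbit z).
Proof.
move=> mX; rewrite -orbit_seqE -[X in measurable X]image_id -bigcup_imset1.
exact: fin_bigcup_measurable.
Qed.

Section averages.
Variable R : realType.

Definition orbit_avg z (F : X -> R) : R :=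
  (size (orbit_seq z))%:R^-1 * \sum_(w <- orbit_seq z) F w.

(* Both sides are obtained from the double sum of [F (permute pi w)] over all
   [w] in the orbit and all [pi]. *)
Lemma orbit_avg_perm z (F : X -> R) :
  orbit_avg z F = n.+1`!%:R^-1 * \sum_(pi : 'S_n.+1) F (permute pi z).
Proof.
have s0 : (size (orbit_seq z))%:R != 0 :> R.
  by rewrite pnatr_eq0 -lt0n size_orbit_seq_gt0.
have f0 : n.+1`!%:R != 0 :> R by rewrite pnatr_eq0 -lt0n fact_gt0.
apply: (mulfI s0); apply: (mulfI f0).
rewrite /orbit_avg mulVKf// mulrCA mulVKf//.
transitivity (\sum_(pi : 'S_n.+1) \sum_(w <- orbit_seq z) F (permute pi w)).
  rewrite -card_Sn mulr_natl -sumr_const; apply: eq_bigr => pi _.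
  by rewrite -(perm_big _ (perm_map_orbit_seq pi z)) big_map.
rewrite exchange_big -sum1_size natr_sum mulr_suml [LHS]big_seq [RHS]big_seq /=.
apply: eq_bigr => w; rewrite mem_orbit_seq inE mul1r => -[rho _ <-].
rewrite (reindex_inj (mulIg rho^-1%g)); apply: eq_bigr => pi _.
by rewrite permuteM permuteK.
Qed.

(** Under the uniform law on the orbit, every position of [z] is equally likely to supply the last
    entry. This ties the quantile, taken over the entries of one tuple, to averages over the orbit.
    Both sides come from the sum of [f (tnth z (pi j))] over all [pi] and [j]. *)
Lemma orbit_avg_zlast z (f : Z -> R) :
  orbit_avg z (f \o @zlast d Z n) = n.+1%:R^-1 * \sum_(i < n.+1) f (tnth z i).
Proof.
have f0 : n.+1`!%:R != 0 :> R by rewrite pnatr_eq0 -lt0n fact_gt0.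
rewrite orbit_avg_perm; apply: (mulfI f0); rewrite mulVKf//.
apply: (@mulfI _ n.+1%:R); first by rewrite pnatr_eq0.
rewrite mulrCA mulVKf ?pnatr_eq0//.
transitivity (\sum_(j < n.+1) \sum_(pi : 'S_n.+1) f (tnth z (pi j))).
  rewrite -[X in X%:R * _](card_ord n.+1) mulr_natl -sumr_const.
  apply: eq_bigr => j _; rewrite (reindex_inj (mulgI (tperm ord_max j))).
  by apply: eq_bigr => pi _; rewrite /= /zlast tnth_permute permM tpermL.
rewrite exchange_big /= -[in RHS](card_Sn n.+1) mulr_natl -sumr_const.
by apply: eq_bigr => pi _; rewrite [RHS](reindex_inj (@perm_inj _ pi)).
Qed.

Lemma orbit_avg_ge0 z (F : X -> R) :
  (forall w, perm_orbit z w -> 0 <= F w) -> 0 <= orbit_avg z F.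
Proof.
move=> F0; rewrite /orbit_avg mulr_ge0//.
by rewrite big_seq sumr_ge0// => w; rewrite mem_orbit_seq inE; exact: F0.
Qed.

Lemma eq_orbit_avg z (F G : X -> R) :
  (forall w, perm_orbit z w -> F w = G w) -> orbit_avg z F = orbit_avg z G.
Proof.
move=> FG; rewrite /orbit_avg !big_seq; congr (_ * _); apply: eq_bigr => w.
by rewrite mem_orbit_seq inE; exact: FG.
Qed.

Lemma orbit_avgB z (F G : X -> R) :
  orbit_avg z (F \- G) = orbit_avg z F - orbit_avg z G.
Proof. by rewrite /orbit_avg -mulrBr sumrB. Qed.

Lemma orbit_avgZ z a (F : X -> R) :
  orbit_avg z (fun w => a * F w) = a * orbit_avg z F.
Proof. by rewrite /orbit_avg -mulr_sumr mulrCA. Qed.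

Lemma orbit_avg_cst z a : orbit_avg z (cst a) = a.
Proof.
rewrite /orbit_avg big_const_seq count_predT iter_addr_0 -[a *+ _]mulr_natl mulKf//.
by rewrite pnatr_eq0 -lt0n size_orbit_seq_gt0.
Qed.

End averages.
End orbits.

(** * Uniform laws and quantiles *)

Section uniform_on_orbits.
Context (R : realType) d (Z : measurableType d).

Lemma unif_entriesE (s : seq Z) (A : set Z) :
  unif_entries R s A = ((size s)%:R^-1 * \sum_(x <- s) \1_A x)%:E.
Proof.
rewrite /unif_entries /= /mscale /= /msum EFinM; congr (_ * _)%E.
by rewrite (big_nth point) big_mkord sumEFin.
Qed.

Lemma unif_entries_fin_num (s : seq Z) : fin_num_fun (unif_entries R s).
Proof. by move=> A _; rewrite unif_entriesE. Qed.

Lemma integral_unif_entries (s : seq Z) (F : Z -> R) :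
  (forall w : Z, measurable [set w]) -> uniq s ->
  (\int[unif_entries R s]_x (F x)%:E =
   ((size s)%:R^-1 * \sum_(x <- s) F x)%:E)%E.
Proof.
move=> mZ us; rewrite (@integral_atoms _ _ _ _ s)//; last first.
- exact: unif_entries_fin_num.
- rewrite unif_entriesE big1_seq ?mulr0// => x /andP[_ xs].
  by rewrite indicE memNset// => /(_ xs).
congr EFin; rewrite mulr_sumr !big_seq; apply: eq_bigr => w ws.
rewrite unif_entriesE /= mulrC; congr (_ * _).
rewrite (bigD1_seq w)//= indicE mem_set// big1 ?addr0 ?mulr1// => x xw.
by rewrite indicE memNset// => xw'; rewrite xw' eqxx in xw.
Qed.

Section counts.
Variables (n : nat) (Y : Z -> R).
Implicit Types (z : n.+1.-tuple Z) (c : R).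

(** This and [num_ge] are the tail probabilities of the empirical law times [n.+1]. As counts they
    are invariant under permutations. *)
Definition num_gt z c : nat := (\sum_(i < n.+1) (c < Y (tnth z i))%R)%N.

Definition num_ge z c : nat := (\sum_(i < n.+1) (c <= Y (tnth z i))%R)%N.

Lemma upper_quantileE z (alpha c : R) :
  upper_quantile (unif_entries R z) Y alpha c <->
  (num_gt z c)%:R <= alpha * n.+1%:R <= (num_ge z c)%:R.
Proof.
have E (P : pred Z) : \sum_(x <- z) \1_[set x | P x] x =
    (\sum_(i < n.+1) P (tnth z i))%N%:R :> R.
  rewrite big_tuple natr_sum; apply: eq_bigr => i _.
  by rewrite indicE; congr (nat_of_bool _)%:R; apply/asboolP/idP.
rewrite /upper_quantile !unif_entriesE !lee_fin size_tuple !E.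
by rewrite ler_pdivrMl// ler_pdivlMl// [n.+1%:R * alpha]mulrC.
Qed.

Lemma num_ge_gt z c c' : c < c' -> (num_ge z c' <= num_gt z c)%N.
Proof.
by move=> cc; apply: leq_sum => i _; case: (leP c') => //= /(lt_le_trans cc) ->.
Qed.

(** Entry [i] itself is counted only on the right. *)
Lemma num_gt_lt_ge z i : (num_gt z (Y (tnth z i)) < num_ge z (Y (tnth z i)))%N.
Proof.
rewrite /num_gt /num_ge (bigD1 i)//= [ltnRHS](bigD1 i)//= ltxx lexx ltnS.
by apply: leq_sum => j _; case: (ltP (Y (tnth z i))) => //= /ltW ->.
Qed.

Lemma num_gt_permute pi z c : num_gt (permute pi z) c = num_gt z c.
Proof.
rewrite /num_gt [RHS](reindex_inj (@perm_inj _ pi)).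
by apply: eq_bigr => i _; rewrite tnth_permute.
Qed.

Lemma num_ge_permute pi z c : num_ge (permute pi z) c = num_ge z c.
Proof.
rewrite /num_ge [RHS](reindex_inj (@perm_inj _ pi)).
by apply: eq_bigr => i _; rewrite tnth_permute.
Qed.

(** The quantile is the largest attained value whose [num_ge] reaches [alpha * n.+1]; the smallest
    attained value qualifies, as all entries count. If [num_gt] were too large there, the next
    larger attained value would qualify as well. *)
Lemma exists_upper_quantile z (alpha : R) : 0 < alpha < 1 ->
  exists c, (num_gt z c)%:R <= alpha * n.+1%:R <= (num_ge z c)%:R.
Proof.
move=> /andP[a0 a1].
pose y i := Y (tnth z i).
pose P (i : 'I_n.+1) := alpha * n.+1%:R <= (num_ge z (y i))%:R.
have [i0 _ i0min] := @arg_minP _ _ _ ord0 predT y isT.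
have Pi0 : P i0.
  rewrite /P (_ : num_ge z (y i0) = n.+1); first by rewrite ler_piMl// ltW.
  rewrite /num_ge (eq_bigr (fun=> 1%N)) => [|i _]; last by rewrite i0min.
  by rewrite sum1_card card_ord.
have [i Pi imax] := @arg_maxP _ _ _ i0 P y Pi0.
exists (y i); rewrite [X in _ && X]Pi andbT leNgt; apply/negP => agt.
have [j0 j0P] : exists j, y i < y j.
  apply/existsP; apply: contraT => /existsPn nj; move: agt.
  rewrite /num_gt big1 => [|j _]; last by rewrite (negbTE (nj j)).
  by rewrite ltNge mulr_ge0// ltW.
have [j jP jmin] := @arg_minP _ _ _ j0 (fun j => y i < y j) y j0P.
suff Pj : P j by have := imax _ Pj; rewrite /= leNgt jP.
rewrite /P (le_trans (ltW agt))// ler_nat; apply: leq_sum => l _.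
by case: (ltP (y i)) => //= /jmin ->.
Qed.

End counts.

End uniform_on_orbits.

(** * Exchangeable laws and orbit averages *)

Section exchangeable_orbits.
Context (R : realType) d (Z : measurableType d) (n : nat).
Local Notation X := (n.+1.-tuple Z).
Hypothesis mX : forall z : X, measurable [set z].

Lemma integral_unif_orbit (z : X) (F : X -> R) :
  (\int[unif_orbit R (perm_orbit z)]_w (F w)%:E = (orbit_avg z F)%:E)%E.
Proof. by apply: integral_unif_entries => //; exact: orbit_seq_uniq. Qed.

(** On the empty set [unif_orbit] is the zero measure; indexing by a tuple ensures total mass 1, so
    that a probability structure can be attached. *)
Definition orbit_law (z : X) : set X -> \bar R := unif_orbit R (perm_orbit z).

HB.instance Definition _ z := Measure.on (orbit_law z).

Lemma orbit_lawE z (A : set X) : orbit_law z A = (orbit_avg z \1_A)%:E.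
Proof. exact: unif_entriesE. Qed.

Let orbit_law_setT z : orbit_law z setT = 1%E.
Proof.
rewrite orbit_lawE -[X in _ = X%:E](orbit_avg_cst z).
by congr EFin; apply: eq_orbit_avg => w _; rewrite indicT.
Qed.

HB.instance Definition _ z :=
  Measure_isProbability.Build _ _ _ (orbit_law z) (orbit_law_setT z).

Lemma exchangeable_orbit_law z : exchangeable (orbit_law z).
Proof.
move=> pi A _; rewrite -[LHS]/(orbit_law z _) -[RHS]/(orbit_law z _).
rewrite !orbit_lawE; congr EFin.
rewrite /orbit_avg; congr (_ * _).
by rewrite -[RHS](perm_big _ (perm_map_orbit_seq pi z)) big_map.
Qed.

Lemma integral_exchangeable (P : probability X R) (pi : 'S_n.+1)
    (F : X -> \bar R) :
  exchangeable P -> measurable_fun setT F -> (forall z, 0 <= F z)%E ->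
  (\int[P]_z F (permute pi z) = \int[P]_z F z)%E.
Proof.
move=> eP mF F0; have mpi := @measurable_permute d Z n pi.
transitivity (\int[pushforward P (permute pi)]_z F z)%E.
  by rewrite ge0_integral_pushforward.
by apply: eq_measure_integral => A mA _; exact: eP.
Qed.

Lemma exchangeable_orbit_avg (P : probability X R) (F : X -> R) :
  exchangeable P -> measurable_fun setT F -> (forall z, 0 <= F z) ->
  (\int[P]_z (F z)%:E = \int[P]_z (orbit_avg z F)%:E)%E.
Proof.
move=> eP mF F0.
have mFpi pi : measurable_fun setT (fun z => (F (permute pi z))%:E).
  apply/measurable_EFinP; apply: measurableT_comp => //.
  exact: measurable_permute.
under [RHS]eq_integral do rewrite orbit_avg_perm EFinM -sumEFin.
rewrite ge0_integralZl_EFin ?invr_ge0//; last 2 first.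
- by move=> z _; rewrite sumEFin lee_fin sumr_ge0.
- exact: emeasurable_sum.
rewrite ge0_integral_sum//; last by move=> pi z _; rewrite lee_fin.
rewrite (eq_bigr (fun=> 1%:E * \int[P]_z (F z)%:E)%E) => [|pi _]; last first.
  rewrite mul1e (integral_exchangeable pi (F := EFin \o F))//.
  exact/measurable_EFinP.
rewrite -ge0_sume_distrl// sumEFin sumr_const card_Sn muleA -EFinM.
by rewrite mulVf ?mul1e// pnatr_eq0 -lt0n fact_gt0.
Qed.

End exchangeable_orbits.

(** * Mixtures over orbits *)

Section orbit_kernels.
Context (R : realType) d (Z : measurableType d) (n : nat).
Local Notation X := (n.+1.-tuple Z).
Variable K : set X -> probability X R.

(** [K] seen as a Markov kernel from tuples to tuples. It carries the proof [hK], on which its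
    kernel structure depends. *)
Definition kernel_of_orbits (hK : orbit_kernel K) : X -> {measure set X -> \bar R} :=
  fun z => K (perm_orbit z).

Hypothesis hK : orbit_kernel K.

Let measurable_kernel_of_orbits U : measurable U ->
  measurable_fun setT (kernel_of_orbits hK ^~ U).
Proof. exact: hK.1. Qed.

HB.instance Definition _ := isKernel.Build _ _ X X R
  (kernel_of_orbits hK) measurable_kernel_of_orbits.

Let kernel_of_orbits_prob z : kernel_of_orbits hK z setT = 1%E.
Proof. exact: probability_setT. Qed.

HB.instance Definition _ := Kernel_isProbability.Build _ _ X X R
  (kernel_of_orbits hK) kernel_of_orbits_prob.

Lemma measurable_orbit_kernel_section (A : set (X * X)) : measurable A ->
  measurable_fun setT (fun z => K (perm_orbit z) (xsection A z)).
Proof.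
move=> mA; apply: (measurable_fun_xsection_finite_kernel (kernel_of_orbits hK)).
exact: mem_set.
Qed.

Lemma measurable_integral_orbit_kernel (F : X -> \bar R) :
  measurable_fun setT F -> (forall z, 0 <= F z)%E ->
  measurable_fun setT (fun z => \int[K (perm_orbit z)]_w F w)%E.
Proof.
by move=> mF F0; apply: (measurable_fun_integral_kernel (l := kernel_of_orbits hK)).
Qed.

(** [P] is the bind of [mu] and the kernel in the Giry monad, where integrals are iterated
    integrals. *)
Lemma integral_orbit_mixture (mu P : probability X R) (F : X -> \bar R) :
  (forall A, measurable A -> P A = \int[mu]_z K (perm_orbit z) A)%E ->
  measurable_fun setT F -> (forall z, 0 <= F z)%E ->
  (\int[P]_z F z = \int[mu]_z \int[K (perm_orbit z)]_w F w)%E.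
Proof.
move=> PE mF F0.
pose f (z : X) : giry X R := K (perm_orbit z).
have mf : measurable_fun setT f.
  by apply: measurable_giry_codensity => // B mB; exact: hK.1.
have bindE := giry_int_bind mu mf.
rewrite -[RHS](bindE F)// /giry_int; apply: eq_measure_integral => A mA _.
transitivity (\int[giry_bind mu mf]_z (\1_A z)%:E)%E; last first.
  by rewrite integral_indic// setIT.
apply: (etrans (PE A mA)); rewrite [RHS](bindE (EFin \o \1_A)); last 2 first.
- exact/measurable_EFinP.
- by move=> z; rewrite lee_fin.
by apply: eq_integral => z _; rewrite /giry_int integral_indic// setIT.
Qed.

Lemma integral_orbit_kernel (z : X) (F : X -> R) :
  (forall z : X, measurable [set z]) ->
  (\int[K (perm_orbit z)]_w (F w)%:E =
   (\sum_(w <- orbit_seq z) F w * fine (K (perm_orbit z) [set w]))%:E)%E.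
Proof.
move=> mX; apply: integral_atoms => //; first exact: orbit_seq_uniq.
  rewrite orbit_seqE; apply: (etrans (probability_setC _ _)).
    exact: measurable_perm_orbit.
  by rewrite hK.2 subee.
Qed.

End orbit_kernels.

Lemma measurable_nat_sum d (T : measurableType d) m (f : 'I_m -> T -> bool) :
  (forall i, measurable_fun setT (f i)) ->
  measurable_fun setT (fun x => \sum_(i < m) f i x)%N.
Proof.
move=> mf; elim: (index_enum _) => [|i s ih].
  by under eq_fun do rewrite big_nil; exact: measurable_cst.
under eq_fun do rewrite big_cons; apply: measurable_fun_addn => //.
exact: (measurableT_comp (f := nat_of_bool)).
Qed.

(** * The Neyman-Pearson e-value *)

Section neyman_pearson_evalue.
Context (R : realType) d (Z : measurableType d) (n : nat).
Local Notation X := (n.+1.-tuple Z).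
Variables (alpha : R) (L : set X -> Z -> R).
Hypothesis halpha : 0 < alpha < 1.
Hypothesis mX : forall z : X, measurable [set z].

Let alpha_gt0 : 0 < alpha. Proof. by case/andP: halpha. Qed.

Let N : R := n.+1%:R.

Lemma exists_orbit_quantile : exists c : set X -> R, forall z : X,
  upper_quantile (unif_entries R z) (L (perm_orbit z)) alpha (c (perm_orbit z)).
Proof.
(* The quantile is chosen for the representative [get O]; the counts do not change along the orbit,
   so it serves every tuple of [O]. *)
exists (fun O => sval (cid (exists_upper_quantile (L O) (get O) halpha))) => z.
apply/upper_quantileE; case: cid => x /=.
by case: (perm_orbit_get z) => pi _ <-; rewrite num_gt_permute num_ge_permute.
Qed.

Section threshold.
Variables c k : set X -> R.

(** [E_NP] with real values and with the orbit separated from the last entry, so that the orbit can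
    stay fixed while the last entry varies. *)
Definition np_value (O : set X) (x : Z) : R :=
  if c O < L O x then alpha^-1 else if L O x == c O then k O else 0.

Lemma E_NPE z : E_NP alpha L c k z = (np_value (perm_orbit z) (zlast z))%:E.
Proof. by rewrite /E_NP /np_value !(fun_if EFin). Qed.

Lemma orbit_avg_np_value z : orbit_avg z (np_value (perm_orbit z) \o @zlast d Z n) =
  N^-1 * ((num_gt (L (perm_orbit z)) z (c (perm_orbit z)))%:R / alpha +
          ((num_ge (L (perm_orbit z)) z (c (perm_orbit z)))%:R -
           (num_gt (L (perm_orbit z)) z (c (perm_orbit z)))%:R) * k (perm_orbit z)).
Proof.
rewrite orbit_avg_zlast; congr (_ * _); rewrite /num_gt /num_ge !natr_sum.
rewrite -sumrB !mulr_suml -big_split /=; apply: eq_bigr => i _; rewrite /np_value.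
by case: ltgtP => _ /=; rewrite ?subrr ?subr0 ?mul0r ?mul1r ?add0r ?addr0.
Qed.

Lemma exact_evalueE : exact_evalue (E_NP alpha L c k) <->
  forall z, orbit_avg z (np_value (perm_orbit z) \o @zlast d Z n) = 1.
Proof.
have E z : (\int[unif_orbit R (perm_orbit z)]_w E_NP alpha L c k w =
    (orbit_avg z (np_value (perm_orbit z) \o @zlast d Z n))%:E)%E.
  under eq_integral do rewrite E_NPE.
  rewrite integral_unif_orbit//; congr EFin.
  by apply: eq_orbit_avg => w /perm_orbit_eq ->.
by split=> e1 z; [have := e1 z; rewrite E => -[]|rewrite E e1].
Qed.

(** Rank the entries by decreasing likelihood ratio: those tied with the last one occupy the
    interval of ranks from [g] to [h]. Each unit of rank below [alpha * N] receives weight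
    [alpha^-1], and tied entries share their total equally. *)
Let rank_value z : R :=
  let Y := L (perm_orbit z) in
  let g := num_gt Y z (Y (zlast z)) in
  let h := num_ge Y z (Y (zlast z)) in
  (Num.min h%:R (alpha * N) - Num.min g%:R (alpha * N)) *
  (alpha^-1 * (h - g)%N%:R^-1).

Hypothesis quantile_c : forall z : X,
  upper_quantile (unif_entries R z) (L (perm_orbit z)) alpha (c (perm_orbit z)).
Hypothesis exact_k : exact_evalue (E_NP alpha L c k).

(* Although [c] and [k] are arbitrary functions of the orbit, exactness
   determines the e-value: it only depends on the numbers of entries whose
   likelihood ratio is larger than, or at least, that of the last entry. *)
Let np_value_rank z : np_value (perm_orbit z) (zlast z) = rank_value z.
Proof.
have /upper_quantileE/andP[] := quantile_c z.
move/exact_evalueE: exact_k => /(_ z); rewrite orbit_avg_np_value.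
rewrite /rank_value /np_value -/N.
set Y := L _; set O := perm_orbit z; set r := Y (zlast z).
have N0 : N != 0 by rewrite pnatr_eq0.
have a0 := lt0r_neq0 alpha_gt0.
move=> /(congr1 ( *%R N)); rewrite mulVKf// mulr1 => exk gc hc.
have gh : (num_gt Y z r < num_ge Y z r)%N by exact: num_gt_lt_ge.
have D0 : (num_ge Y z r - num_gt Y z r)%N%:R != 0 :> R.
  by rewrite pnatr_eq0 subn_eq0 -ltnNge.
(* Above the threshold both counts are at most [alpha * N], below it both are at least [alpha * N].
   At the threshold [alpha * N] lies between them and exactness determines [k]. *)
have [cr|rc|rc] := ltgtP (c O) r.
- have hN : (num_ge Y z r)%:R <= alpha * N.
    by rewrite (le_trans _ gc)// ler_nat; exact: num_ge_gt.
  have gN : (num_gt Y z r)%:R <= alpha * N.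
    by rewrite (le_trans _ hN)// ler_nat ltnW.
  by rewrite !min_l// -natrB 1?ltnW// mulrCA mulfV// mulr1.
- have gN : alpha * N <= (num_gt Y z r)%:R.
    by rewrite (le_trans hc)// ler_nat; exact: num_ge_gt.
  have hN : alpha * N <= (num_ge Y z r)%:R.
    by rewrite (le_trans gN)// ler_nat ltnW.
  by rewrite !min_r// subrr mul0r.
rewrite rc in gc hc exk; rewrite min_r// min_l//.
move: exk D0; rewrite natrB 1?ltnW// -/O => exk D0.
by rewrite -exk; field; rewrite D0 a0.
Qed.

(** The sign of [k] is not assumed: it follows from the rank formula, as [Num.min] is monotone and
    [g < h]. *)
Lemma np_value_ge0 z : 0 <= np_value (perm_orbit z) (zlast z).
Proof.
rewrite np_value_rank mulr_ge0//; last by rewrite mulr_ge0// invr_ge0// ltW.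
rewrite subr_ge0 le_min !ge_min lexx orbT andbT ler_nat ltnW//.
exact: num_gt_lt_ge.
Qed.

(** Taking the minimum with [alpha * N] cannot increase the distance between [g] and [h]. *)
Lemma np_value_le z : np_value (perm_orbit z) (zlast z) <= alpha^-1.
Proof.
rewrite np_value_rank /rank_value mulrCA ger_pMr ?invr_gt0//.
set g := num_gt _ _ _; set h := num_ge _ _ _.
have gh : (g < h)%N by exact: num_gt_lt_ge.
rewrite ler_pdivrMr ?mul1r ?ltr0n ?subn_gt0// natrB 1?ltnW//.
have ghR : g%:R <= h%:R :> R by rewrite ler_nat ltnW.
by case: (leP h%:R) => ?; case: (leP g%:R) => ?; lra.
Qed.

Hypothesis mL : forall i : 'I_n.+1,
  measurable_fun setT (fun z : X => L (perm_orbit z) (tnth z i)).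

(** The rank formula no longer mentions [c] and [k]; its counts are finite sums of measurable
    comparisons. *)
Lemma measurable_np_value :
  measurable_fun setT (fun z : X => np_value (perm_orbit z) (zlast z)).
Proof.
under eq_fun do rewrite np_value_rank /rank_value.
have mge : measurable_fun setT (fun z : X =>
    num_ge (L (perm_orbit z)) z (L (perm_orbit z) (zlast z))).
  by apply: measurable_nat_sum => i; apply: measurable_fun_ler; exact: mL.
have mgt : measurable_fun setT (fun z : X =>
    num_gt (L (perm_orbit z)) z (L (perm_orbit z) (zlast z))).
  by apply: measurable_nat_sum => i; apply: measurable_fun_ltr; exact: mL.
apply: measurable_funM.
  by apply: measurable_funB; apply: measurable_minr => //;
    apply: measurableT_comp.
apply: measurable_funM => //.
apply: (measurableT_comp (f := fun m : nat => m%:R^-1 : R)) => //.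
exact: measurable_fun_subn.
Qed.

Lemma E_NP_valid : valid (E_NP alpha L c k).
Proof.
split; first split.
- rewrite (funext E_NPE); apply/measurable_EFinP.
  exact: measurable_np_value.
- by move=> z; rewrite E_NPE lee_fin np_value_ge0.
move=> P eP; under eq_integral do rewrite E_NPE.
rewrite exchangeable_orbit_avg//; last 2 first.
- exact: measurable_np_value.
- exact: np_value_ge0.
rewrite (eq_integral (cst 1%E)) => [|z _].
  by rewrite integral_cst// mul1e; exact: probability_le1.
rewrite (_ : orbit_avg _ _ = orbit_avg z (np_value (perm_orbit z) \o @zlast d Z n)).
  by move/exact_evalueE: exact_k => ->.
by apply: eq_orbit_avg => w /perm_orbit_eq ->.
Qed.

(** An e-value may be infinite, but its utility is at most [alpha^-1] and can be treated as a real
    function. *)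
Let truncate (E : X -> \bar R) (z : X) : R := fine (U_NP alpha (E z)).

Let truncateE (E : X -> \bar R) z : (0 <= E z)%E ->
  U_NP alpha (E z) = (truncate E z)%:E.
Proof.
move=> E0; rewrite /truncate fineK// /U_NP.
by rewrite ge0_fin_numE ?le_min ?E0 ?lee_fin ?invr_ge0 ?ltW// gt_min ltry orbT.
Qed.

Let truncate_ge0 E z : (0 <= E z)%E -> 0 <= truncate E z.
Proof.
by move=> E0; apply: fine_ge0; rewrite le_min E0 lee_fin invr_ge0 ltW.
Qed.

Let truncate_le E z : (0 <= E z)%E -> truncate E z <= alpha^-1.
Proof. by move=> E0; rewrite -lee_fin -truncateE// ge_min lexx orbT. Qed.

Let measurable_U_NP (E : X -> \bar R) : measurable_fun setT E ->
  measurable_fun setT (fun z => U_NP alpha (E z)).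
Proof. by move=> mE; apply: measurable_mine. Qed.

(** Validity is tested against the uniform law on the orbit, which is exchangeable. *)
Let orbit_avg_truncate E z : valid E -> orbit_avg z (truncate E) <= 1.
Proof.
move=> [[mE E0] vE]; rewrite -lee_fin -integral_unif_orbit//.
apply: le_trans (vE _ (exchangeable_orbit_law R z)).
under eq_integral do rewrite -truncateE//.
apply: ge0_le_integral => //.
- by move=> w _; rewrite truncateE// lee_fin truncate_ge0.
- exact: measurable_U_NP.
- by move=> w _; rewrite ge_min lexx.
Qed.

Let U_NP_E_NP z :
  U_NP alpha (E_NP alpha L c k z) = (np_value (perm_orbit z) (zlast z))%:E.
Proof. by rewrite /U_NP E_NPE min_l// lee_fin np_value_le. Qed.

(* As [u <= 1 / alpha], the difference [u - np_value] is nonpositive where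
   [L > c] and nonnegative where [L < c], so that its product with [g L - g c]
   is nonpositive. *)
Let neyman_pearson_orbit (g : R -> R) (u : X -> R) z :
  (forall x y, x <= y -> g x <= g y) ->
  (forall w, perm_orbit z w -> 0 <= g (L (perm_orbit z) (zlast w))) ->
  (forall w, 0 <= u w <= alpha^-1) -> orbit_avg z u <= 1 ->
  orbit_avg z (fun w => g (L (perm_orbit z) (zlast w)) * u w) <=
  orbit_avg z (fun w => g (L (perm_orbit z) (zlast w)) *
                        np_value (perm_orbit z) (zlast w)).
Proof.
set O := perm_orbit z => ndg g0 u01 u1.
have gc0 : 0 <= g (c O).
  have /upper_quantileE/andP[gc _] := quantile_c z.
  (* Otherwise [num_gt] would be [n.+1], which exceeds [alpha * n.+1]. *)
  have [i Lc] : exists i, L O (tnth z i) <= c O.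
    apply: contrapT => /forallNP Lc; move: gc.
    rewrite /num_gt (eq_bigr (fun=> 1%N)) => [|i _]; last first.
      by rewrite ltNge; have /negP/negbTE -> := Lc i.
    rewrite sum1_card card_ord leNgt gtr_pMl ?ltr0n//.
    by case/andP: halpha => _ ->.
  apply: le_trans (g0 _ (mem_perm_orbit (tperm i ord_max) z)) _.
  by rewrite /zlast tnth_permute tpermR; exact: ndg.
have np1 : orbit_avg z (np_value O \o @zlast d Z n) = 1.
  by move/exact_evalueE: exact_k.
rewrite -subr_le0 -orbit_avgB.
have uv : g (c O) * orbit_avg z (u \- (np_value O \o @zlast d Z n)) <= 0.
  by rewrite orbit_avgB np1 mulr_ge0_le0// subr_le0.
apply: le_trans uv; rewrite -orbit_avgZ -subr_le0 -orbit_avgB.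
rewrite -oppr_ge0 -mulN1r -orbit_avgZ; apply: orbit_avg_ge0 => w _ /=.
rewrite mulN1r oppr_ge0 -!mulrBr -mulrBl /np_value.
have /andP[u0 ua] := u01 w.
case: ltgtP => [cL|Lc|<-]; last by rewrite subrr mul0r.
  by rewrite mulr_ge0_le0 ?subr_ge0 ?subr_le0// ndg// ltW.
by rewrite mulr_le0_ge0 ?subr_le0 ?subr0// ndg// ltW.
Qed.

(** The common form of all optimality claims: [g] composed with [L] is the density of [Kt] on each
    orbit, with [g] the identity for mixtures of the original kernel. The utilities are compared
    orbit by orbit and then integrated against [mu]. *)
Lemma E_NP_U_optimal (Kt : set X -> probability X R) (g : set X -> R -> R)
    (Qt : probability X R) :
  orbit_kernel Kt ->
  (forall (z : X) (x y : R),
     x <= y -> g (perm_orbit z) x <= g (perm_orbit z) y) ->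
  (forall z w : X, perm_orbit z w -> Kt (perm_orbit z) [set w] =
     ((size (orbit_seq z))%:R^-1 *
      g (perm_orbit z) (L (perm_orbit z) (zlast w)))%:E) ->
  orbit_mixture Kt Qt ->
  U_optimal (U_NP alpha) Qt (E_NP alpha L c k).
Proof.
move=> hKt ndg KtE [mu QtE]; split=> [|E vE]; first exact: E_NP_valid.
have [[mE E0] _] := vE; have [[mNP NP0] _] := E_NP_valid.
have U0 (F : X -> \bar R) z : (0 <= F z -> 0 <= U_NP alpha (F z))%E.
  by move=> F0; rewrite truncateE// lee_fin truncate_ge0.
rewrite !(integral_orbit_mixture hKt QtE)//; try exact: measurable_U_NP;
  try by move=> z; exact: U0.
have intE (F : X -> R) z : (\int[Kt (perm_orbit z)]_w (F w)%:E =
    (orbit_avg z (fun w =>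
       g (perm_orbit z) (L (perm_orbit z) (zlast w)) * F w))%:E)%E.
  rewrite integral_orbit_kernel// /orbit_avg mulr_sumr !big_seq; congr EFin.
  apply: eq_bigr => w; rewrite mem_orbit_seq inE => /KtE ->.
  by rewrite mulrC mulrA.
apply: ge0_le_integral => //.
- by move=> z _; apply: integral_ge0 => w _; exact: U0.
- by apply: measurable_integral_orbit_kernel => // [|z];
    [exact: measurable_U_NP|exact: U0].
- by apply: measurable_integral_orbit_kernel => // [|z];
    [exact: measurable_U_NP|exact: U0].
move=> z _.
under eq_integral do rewrite truncateE//.
under [leRHS]eq_integral do rewrite U_NP_E_NP.
rewrite !intE lee_fin.
rewrite [leRHS](_ : _ = orbit_avg z (fun w =>
    g (perm_orbit z) (L (perm_orbit z) (zlast w)) *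
    np_value (perm_orbit z) (zlast w))); last first.
  by apply: eq_orbit_avg => w /perm_orbit_eq ->.
apply: neyman_pearson_orbit.
- exact: ndg.
- move=> w zw; have : (0 <= Kt (perm_orbit z) [set w])%E by [].
  by rewrite KtE// lee_fin pmulr_rge0// invr_gt0 ltr0n size_orbit_seq_gt0.
- by move=> w; rewrite truncate_ge0 ?truncate_le.
- exact: orbit_avg_truncate.
Qed.

End threshold.

Lemma exists_exact_constant (c : set X -> R) :
  (forall z : X, upper_quantile (unif_entries R z) (L (perm_orbit z))
     alpha (c (perm_orbit z))) ->
  exists k : set X -> R, exact_evalue (E_NP alpha L c k).
Proof.
move=> quantile_c.
pose g (O : set X) : R := (num_gt (L O) (get O : X) (c O))%:R.
pose h (O : set X) : R := (num_ge (L O) (get O : X) (c O))%:R.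
(* The solution of the exactness equation given by [orbit_avg_np_value], which is linear in [k]. *)
exists (fun O => (N - g O / alpha) / (h O - g O)); apply/exact_evalueE => z.
have /upper_quantileE/andP[] := quantile_c z; rewrite orbit_avg_np_value.
rewrite /g /h; case: (perm_orbit_get z) => pi _ <-.
rewrite num_gt_permute num_ge_permute.
set G := (num_gt _ _ _)%:R; set H := (num_ge _ _ _)%:R => Ga aH.
have N0 : N != 0 by rewrite pnatr_eq0.
have a0 := lt0r_neq0 alpha_gt0.
apply: (mulfI N0); rewrite mulVKf// mulr1.
(* If no entry attains the threshold, the quantile inequalities force [G = alpha * N], and the
   entries above it already give average 1, whatever the quotient by zero is. *)
have [HG|HG] := eqVneq H G.
  rewrite HG subrr mul0r addr0; rewrite HG in aH.
  by rewrite (le_anti (introT andP (conj Ga aH))) mulrAC mulfV// mul1r.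
by rewrite [(H - G) * _]mulrC divfK ?subr_eq0// addrC subrK.
Qed.

End neyman_pearson_evalue.

(** * The likelihood ratio of the last entry *)

Section likelihood_ratio_of_last.
Context (R : realType) d (Z : measurableType d) (n : nat).
Local Notation X := (n.+1.-tuple Z).
Hypothesis mdiag : measurable [set p : Z * Z | p.1 = p.2].
Variable K : set X -> probability X R.
Hypothesis hK : orbit_kernel K.

Let measurable_equalizer d' (T : measurableType d') (f g : T -> Z) :
  measurable_fun setT f -> measurable_fun setT g ->
  measurable [set t | f t = g t].
Proof.
move=> mf mg; rewrite -[X in measurable X]setTI.
exact: (measurable_fun_pair mf mg measurableT mdiag).
Qed.

(** The event whose mass is taken varies with [z]: it is the section at [z] of a subset of [X * X],
    measurable because the diagonal of [Z] is. *)
Lemma measurable_LR_last (i : 'I_n.+1) :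
  measurable_fun setT (fun z : X => LR_last K (perm_orbit z) (tnth z i)).
Proof.
apply: measurable_funM => //; apply: measurable_funM.
  pose A := [set p : X * X | tnth p.1 i = zlast p.2].
  have mA : measurable A.
    apply: measurable_equalizer.
      exact: (measurableT_comp (measurable_tnth i) measurable_fst).
    exact: (measurableT_comp (measurable_tnth ord_max) measurable_snd).
  have := measurable_orbit_kernel_section hK mA.
  move/(measurableT_comp (fine_measurable (@measurableT _ (\bar R)))).
  congr measurable_fun; apply/funext => z /=; congr (fine (K _ _)).
  by apply/seteqP; split=> w; rewrite /xsection /= inE => /esym.
under eq_fun do rewrite mult_perm_orbit count_mem_tuple.
apply: (measurableT_comp (f := fun m : nat => m%:R^-1 : R)) => //.
apply: measurable_nat_sum => j; apply: (measurable_fun_bool true).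
rewrite setTI (_ : _ @^-1` _ = [set z : X | tnth z j = tnth z i]).
  apply: measurable_equalizer; exact: measurable_tnth.
by apply/seteqP; split=> z /= /eqP.
Qed.

Hypothesis mX : forall z : X, measurable [set z].
Hypothesis hKinit : forall z : X, exchangeable_init (K (perm_orbit z)).

Let kernel_eq_last (z w v : X) : perm_orbit z w -> perm_orbit z v ->
  zlast v = zlast w -> K (perm_orbit z) [set v] = K (perm_orbit z) [set w].
Proof.
move=> zw zv vw; have wv : perm_orbit w v by rewrite (perm_orbit_eq zw).
have [pi pimax ->] := tnth_last_split wv vw.
rewrite -[LHS](hKinit z pimax)//; congr (K _ _); apply/seteqP; split=> u /=.
  by move/(can_inj (permuteK pi)).
by move=> ->.
Qed.

(** All tuples of the orbit with last entry [x] have the same mass, and by [orbit_avg_zlast] they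
    form a fraction [mult O x / n.+1] of the orbit. Hence [LR_last] is the density with respect to
    the uniform law. *)
Lemma kernel_singletonE (z w : X) : perm_orbit z w ->
  K (perm_orbit z) [set w] =
  ((size (orbit_seq z))%:R^-1 * LR_last K (perm_orbit z) (zlast w))%:E.
Proof.
move=> zw; set O := perm_orbit z; set x := zlast w.
pose kw := fine (K O [set w]).
have mx : measurable [set v : X | zlast v = x].
  by apply: measurable_equalizer => //; exact: measurable_tnth.
have KxE : fine (K O [set v | zlast v = x]) =
    (size (orbit_seq z))%:R * (n.+1%:R^-1 * (mult O x)%:R) * kw.
  have := integral_orbit_kernel hK z \1_[set v : X | zlast v = x] mX.
  rewrite integral_indic// setIT => ->.
  rewrite [fine _](_ : _ = \sum_(v <- orbit_seq z) (zlast v == x)%:R * kw).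
    rewrite -mulr_suml; congr (_ * _).
    have := orbit_avg_zlast z (fun y => (y == x)%:R : R).
    rewrite -natr_sum -count_mem_tuple -mult_perm_orbit => <-.
    by rewrite mulVKf// pnatr_eq0 -lt0n size_orbit_seq_gt0.
  rewrite /= !big_seq; apply: eq_bigr => v; rewrite mem_orbit_seq inE => zv.
  rewrite indicE; have [vx|vx] := eqVneq (zlast v) x.
    by rewrite mem_set// (kernel_eq_last zw).
  by rewrite memNset ?mul0r// => /eqP; rewrite (negbTE vx).
have m0 : (mult O x)%:R != 0 :> R.
  rewrite pnatr_eq0 -lt0n /O -(perm_orbit_eq zw) mult_perm_orbit.
  by rewrite -has_count has_pred1 mem_tnth.
have s0 : (size (orbit_seq z))%:R != 0 :> R.
  by rewrite pnatr_eq0 -lt0n size_orbit_seq_gt0.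
have n0 : n.+1%:R != 0 :> R by rewrite pnatr_eq0.
rewrite -[LHS]fineK ?fin_num_measure// -/kw /LR_last KxE; congr EFin.
by field; rewrite m0 s0 addrC natr1 n0.
Qed.

End likelihood_ratio_of_last.

Lemma orbit_LR_singleton (R : realType) d (Z : measurableType d) (n : nat)
    (K : set (n.+1.-tuple Z) -> probability (n.+1.-tuple Z) R)
    (L : set (n.+1.-tuple Z) -> n.+1.-tuple Z -> R) (z w : n.+1.-tuple Z) :
  (forall z : n.+1.-tuple Z, measurable [set z]) ->
  orbit_LR K L -> perm_orbit z w ->
  K (perm_orbit z) [set w] =
  ((size (orbit_seq z))%:R^-1 * L (perm_orbit z) w)%:E.
Proof.
move=> mX KL zw; rewrite KL// integral_mkcond.
rewrite (eq_integral (fun v => (L (perm_orbit z) v * \1_[set w] v)%:E)).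
  rewrite integral_unif_orbit//; congr (_ * _)%:E.
  rewrite (bigD1_seq w) ?orbit_seq_uniq ?mem_orbit_seq ?inE//=.
  rewrite indicE mem_set// mulr1 big1 ?addr0// => v vw.
  by rewrite indicE memNset ?mulr0// => v'; rewrite v' eqxx in vw.
by move=> v _; rewrite patchE indicE; case: ifP; rewrite ?mulr1 ?mulr0.
Qed.

Theorem theorem8 (R : realType) (d : measure_display) (Z : measurableType d)
    (hZ : standard_borel R Z) (n : nat) (alpha : R) (halpha : 0 < alpha < 1)
    (Q : probability (n.+1.-tuple Z) R) (hQ : exchangeable_init Q)
    (K : set (n.+1.-tuple Z) -> probability (n.+1.-tuple Z) R)
    (hK : orbit_conditional Q K)
    (hKinit : forall z : n.+1.-tuple Z, exchangeable_init (K (perm_orbit z))) :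
  (exists c : set (n.+1.-tuple Z) -> R, forall z : n.+1.-tuple Z,
     upper_quantile (unif_entries R z) (LR_last K (perm_orbit z))
       alpha (c (perm_orbit z))) /\
  forall c : set (n.+1.-tuple Z) -> R,
    (forall z : n.+1.-tuple Z,
       upper_quantile (unif_entries R z) (LR_last K (perm_orbit z))
       alpha (c (perm_orbit z))) ->
    (exists k : set (n.+1.-tuple Z) -> R,
       exact_evalue (E_NP alpha (LR_last K) c k)) /\
    forall k : set (n.+1.-tuple Z) -> R,
      exact_evalue (E_NP alpha (LR_last K) c k) ->
      [/\ U_optimal (U_NP alpha) Q (E_NP alpha (LR_last K) c k),
          (forall Qt : probability (n.+1.-tuple Z) R,
             orbit_mixture K Qt ->
             U_optimal (U_NP alpha) Qt (E_NP alpha (LR_last K) c k)) &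
          (forall (Kt : set (n.+1.-tuple Z) -> probability (n.+1.-tuple Z) R)
             (g : set (n.+1.-tuple Z) -> R -> R)
             (Qt : probability (n.+1.-tuple Z) R),
             orbit_kernel Kt ->
             (forall (z : n.+1.-tuple Z) (x y : R),
                x <= y -> g (perm_orbit z) x <= g (perm_orbit z) y) ->
             orbit_LR Kt (fun O w => g O (LR_last K O (zlast w))) ->
             orbit_mixture Kt Qt ->
             U_optimal (U_NP alpha) Qt (E_NP alpha (LR_last K) c k))].
Proof.
have mdiag := measurable_diagonal hZ.
have mX := measurable_tuple_singleton hZ.
have [okK dK] := hK.
have mL := measurable_LR_last mdiag okK.
split; first exact: exists_orbit_quantile.
move=> c qc; split; first exact: exists_exact_constant.
move=> k ek.
have optimal := E_NP_U_optimal halpha (mX _) qc ek mL.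
have optimalK Qt : orbit_mixture K Qt ->
    U_optimal (U_NP alpha) Qt (E_NP alpha (LR_last K) c k).
  apply: (optimal K (fun=> id)) => // z w zw.
  exact: kernel_singletonE.
split=> //.
  (* Disintegration over all orbits presents [Q] as a mixture with mixing law [Q] itself. *)
  apply: optimalK; exists Q => A mA.
  by have := dK A setT mA; rewrite preimage_setT setIT => <-.
move=> Kt g Qt okKt ndg lr; apply: (optimal Kt g) => // z w zw.
by rewrite (orbit_LR_singleton (mX _) lr zw).
Qed.
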